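(* Let $d\ge1$ be an integer, let $\mathbf X=(X_1,\dots,X_d)$ be any random vector in $\mathbb R^d$ and let $\mathbf G=(G_1,\dots,G_d)$ be a Gaussian random vector with identity covariance matrix. Then $$d_{\mathrm K}(\mathbf X,\mathbf G)\le 3\log^{1/4}(d+1)\sqrt{W_1(\mathbf X,\mathbf G)}.$$
   Context: The Kolmogorov distance is $d_{\mathrm K}(\mathbf X,\mathbf G)=\sup|\mathbb P[\mathbf X\in Q]-\mathbb P[\mathbf G\in Q]|$, the supremum over all sets $Q=(-\infty,a_1]\times\dots\times(-\infty,a_d]$ with $a_i\in\mathbb R$. The $1$-Wasserstein distance is $W_1(\mathbf X,\mathbf G)=\inf\mathbb E\|\mathbf U-\mathbf V\|$, the infimum over all couplings $(\mathbf U,\mathbf V)$ with $\mathbf U\overset{law}{=}\mathbf X$, $\mathbf V\overset{law}{=}\mathbf G$, where $\|\cdot\|$ is the Euclidean norm (it may equal $+\infty$). *)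

(* Defs.v *)
(* R^d is modelled as [d.-tuple R], equipped with the
   product sigma-algebra generated by the coordinate projections (library). *)
From HB Require Import structures.
From mathcomp Require Import all_boot all_order all_algebra.
From mathcomp Require Import all_classical all_reals all_analysis.
Set Implicit Arguments. Unset Strict Implicit. Unset Printing Implicit Defensive.
Import Order.TTheory GRing.Theory Num.Def Num.Theory.
Local Open Scope classical_set_scope.
Local Open Scope ring_scope.

Section defs.
Context {R : realType} {d : nat}.

Definition eucl_norm (x : d.-tuple R) : R :=
  Num.sqrt (\sum_(i < d) (tnth x i) ^+ 2).

Definition orthant (a : d.-tuple R) : set (d.-tuple R) :=
  [set x | forall i : 'I_d, tnth x i <= tnth a i].

(* Gaussian random vector with mean m and identity covariance matrix:
   every nontrivial linear combination <c,G> is N(<c,m>, c^T I c). *)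
Definition gaussian_id_cov dT (T : measurableType dT) (P : probability T R)
    (G : {RV P >-> d.-tuple R}) (m : d.-tuple R) : Prop :=
  forall c : 'I_d -> R, (exists i, c i != 0) ->
    forall A : set R, measurable A ->
      pushforward P (fun w => \sum_(i < d) c i * tnth (G w) i) A
      = normal_prob (\sum_(i < d) c i * tnth m i)
                    (Num.sqrt (\sum_(i < d) c i ^+ 2)) A.

Definition kolmogorov_dist dT (T : measurableType dT) (P : probability T R)
    (X : {RV P >-> d.-tuple R})
    dT' (T' : measurableType dT') (P' : probability T' R)
    (G : {RV P' >-> d.-tuple R}) : \bar R :=
  ereal_sup [set `| P (X @^-1` orthant a) - P' (G @^-1` orthant a) |%E
            | a in [set: d.-tuple R]].

Definition wasserstein1 dT (T : measurableType dT) (P : probability T R)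
    (X : {RV P >-> d.-tuple R})
    dT' (T' : measurableType dT') (P' : probability T' R)
    (G : {RV P' >-> d.-tuple R}) : \bar R :=
  ereal_inf [set r | exists (dO : measure_display) (O : measurableType dO)
      (Q : probability O R) (U V : {RV Q >-> d.-tuple R}),
      (forall A, measurable A -> distribution Q U A = distribution P X A) /\
      (forall A, measurable A -> distribution Q V A = distribution P' G A) /\
      r = (\int[Q]_w (eucl_norm [tuple tnth (U w) i - tnth (V w) i | i < d])%:E)%E].

End defs.

(* Main.v *)
(** Fix a coupling [(U, V)] of [X] and [G].  If [U] lies in the orthant at [a],
    then either [V] lies in the orthant at [a + e] or [|U - V| >= e]; by Markov's
    inequality the Kolmogorov distance is at most [r / e] plus the Gaussian mass
    between the two orthants, where [r] is the transport cost.  The coordinates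
    of [G] being independent, that mass is a difference of products of normal
    distribution functions.  From [phi(u) <= A (1 - Phi(u)) + phi(A)] with
    [A = sqrt (2 ln (d + 1))] it is at most [(9/4) e sqrt (ln (d + 1))], and the
    claim follows by optimising over [e].

    Independence is not part of the hypothesis, which only gives the laws of the
    linear combinations of the coordinates.  It is recovered one coordinate at a
    time: the characteristic function of a normal law (obtained from its
    differential equation) shows that a coordinate [Y] satisfies
    [E (cos (t Y + b) H) = 0] for the relevant centred [H], and integrating this
    against Gaussian weights in [t] and Lebesgue measure in [b], then letting the
    width of the resulting kernel tend to [0], gives [E (1_(Y <= a) H) = 0]. *)
Require Import Defs.
From HB Require Import structures.
From mathcomp Require Import all_boot all_order all_algebra.
From mathcomp Require Import all_classical all_reals all_analysis.
From mathcomp Require Import measurable_realfun ring lra.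
Import Order.TTheory GRing.Theory Num.Def Num.Theory.
Import numFieldNormedType.Exports.
Set Implicit Arguments. Unset Strict Implicit. Unset Printing Implicit Defensive.
Local Open Scope classical_set_scope.
Local Open Scope ring_scope.

(** * Normal densities and integrals of derivatives over the real line *)

Section normal_density.
Context {R : realType}.
Implicit Types m s t b x : R.
Local Notation mu := (@lebesgue_measure R).

(** The Radon-Nikodym derivative of the normal law agrees almost everywhere with [normal_pdf], since
    both have the same integral over every measurable set. *)
Lemma integral_normal_prob m s (f : R -> \bar R) :
  (normal_prob m s).-integrable [set: R] f ->
  (\int[normal_prob m s]_x f x = \int[mu]_x (f x * (normal_pdf m s x)%:E))%E.
Proof.
move=> intf; have /integrableP[mf _] := intf.
rewrite -(Radon_Nikodym_change_of_variables (normal_prob_dominates m s))//=.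
apply: ae_eq_integral => //.
- apply: emeasurable_funM => //; apply: (measurable_int mu).
  by apply: Radon_Nikodym_integrable; exact: normal_prob_dominates.
- apply: emeasurable_funM => //=; apply/measurable_EFinP.
  exact: measurable_normal_pdf.
- apply: ae_eqe_mul2l => /=.
  rewrite Radon_NikodymE//=; first exact: normal_prob_dominates.
  move=> h; case: cid => /= g [g1 g2 g3].
  apply: integral_ae_eq => //=.
  + by apply/measurable_EFinP; exact: measurable_normal_pdf.
  + by move=> E _ mE; rewrite -g3.
Qed.

Global Instance is_derive_normal_pdf m s x : s != 0 ->
  is_derive x 1 (normal_pdf m s) (- ((x - m) / s ^+ 2) * normal_pdf m s x).
Proof.
move=> s0; rewrite normal_pdfE//.
have s2 : s ^+ 2 *+ 2 != 0 by rewrite mulrn_eq0/= sqrf_eq0.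
apply: is_derive_eq.
rewrite /GRing.scale /= /normal_fun.
by field.
Qed.

Lemma integrable_bounded_normal_pdf m s (f : R -> R) (k : R) :
  measurable_fun [set: R] f -> (forall x, `|f x| <= k) ->
  mu.-integrable [set: R] (fun x => (f x * normal_pdf m s x)%:E).
Proof.
move=> mf fk.
apply: (@le_integrable _ _ _ mu _ measurableT _
    (fun x => k%:E * (normal_pdf m s x)%:E)%E).
- apply/measurable_EFinP/measurable_funM => //; exact: measurable_normal_pdf.
- move=> x _; rewrite /= lee_fin !normrM ler_wpM2r//.
  by rewrite (le_trans (fk x))// ler_norm.
- by apply: integrableZl => //; exact: integrable_normal_pdf.
Qed.

(* [|y| <= 2 s exp (y^2 / (4 s^2))], so the linear factor is absorbed by
   doubling the standard deviation. *)
Lemma normal_pdf_first_moment_le m s x : 0 < s ->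
  `|x - m| * normal_pdf m s x <= 4 * s * normal_pdf m (2 * s) x.
Proof.
move=> s0; have s1 : s != 0 by rewrite gt_eqF.
have s2 : 2 * s != 0 by rewrite mulf_neq0.
rewrite !normal_pdfE//.
have -> : normal_peak s = 2 * normal_peak (2 * s).
  rewrite /normal_peak.
  have -> : (2 * s) ^+ 2 * pi *+ 2 = 2 ^+ 2 * (s ^+ 2 * pi *+ 2) by ring.
  rewrite sqrtrM ?sqr_ge0// sqrtr_sqr.
  by rewrite ger0_norm// invfM mulrA divff// mul1r.
set p := normal_peak (2 * s); have p0 : 0 <= p by exact: normal_peak_ge0.
suff : `|x - m| * normal_fun m s x <= 2 * s * normal_fun m (2 * s) x.
  by move=> /(ler_wpM2l p0) h; lra.
rewrite /normal_fun; set y := x - m.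
have y1 : `|y| <= 2 * s * expR (y ^+ 2 / (4 * s ^+ 2)).
  rewrite (@le_trans _ _ (2 * s * (1 + y ^+ 2 / (4 * s ^+ 2))))//; last first.
    by rewrite ler_wpM2l ?expR_ge1Dx// mulr_ge0// ltW.
  rewrite mulrDr mulr1 -(@ler_pM2r _ (2 * s)); last by rewrite mulr_gt0.
  have -> : (2 * s + 2 * s * (y ^+ 2 / (4 * s ^+ 2))) * (2 * s) =
    4 * s ^+ 2 + y ^+ 2 by field.
  rewrite -(real_normK (num_real y)).
  have := sqr_ge0 (`|y| - 2 * s); have := normr_ge0 y; nra.
apply: le_trans (ler_wpM2r (expR_ge0 _) y1) _.
rewrite -(mulrA (2 * s)) -expRD ler_wpM2l//; first by rewrite mulr_ge0// ltW.
rewrite ler_expR -subr_ge0.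
have -> : - y ^+ 2 / ((2 * s) ^+ 2 *+ 2) -
    (y ^+ 2 / (4 * s ^+ 2) + - y ^+ 2 / (s ^+ 2 *+ 2)) =
    y ^+ 2 / (8 * s ^+ 2) by field.
by apply: divr_ge0; [exact: sqr_ge0|apply: mulr_ge0 => //; exact: sqr_ge0].
Qed.

Lemma integrable_norm_normal_pdf m s : 0 < s ->
  mu.-integrable [set: R] (fun x => (`|x - m| * normal_pdf m s x)%:E).
Proof.
move=> s0; apply: (@le_integrable _ _ _ mu _ measurableT _
    (fun x => (4 * s)%:E * (normal_pdf m (2 * s) x)%:E)%E).
- apply/measurable_EFinP/measurable_funM; last exact: measurable_normal_pdf.
  by apply: measurableT_comp => //; exact: measurable_funB.
- move=> x _; rewrite /= lee_fin ger0_norm ?mulr_ge0 ?normal_pdf_ge0//.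
  by rewrite (le_trans (normal_pdf_first_moment_le _ _ s0))// ler_norm.
- by apply: integrableZl => //; exact: integrable_normal_pdf.
Qed.

Lemma measurable_cosM (u v : R) : measurable_fun [set: R] (fun x => cos (u * x + v)).
Proof.
apply: (measurableT_comp (continuous_measurable_fun (@continuous_cos R))).
by apply: measurable_funD => //; exact: measurable_funM.
Qed.

(** The fundamental theorem of calculus applies on bounded intervals exhausting the line. Dominated
    convergence with majorant [|f|] passes to the limit, where the boundary terms vanish. *)
Lemma integralT_derivative_eq0 (F f : R -> R) (c : R) :
  (forall x, is_derive x 1 F (f x)) -> continuous f ->
  mu.-integrable [set: R] (EFin \o f) ->
  F (c + n%:R) @[n --> \oo] --> 0 -> F (c - n%:R) @[n --> \oo] --> 0 ->
  (\int[mu]_x (f x)%:E = 0)%E.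
Proof.
move=> dF cf intf Fy FNy.
have mf : measurable_fun [set: R] (EFin \o f) by case/integrableP : intf.
(* [n.+1] rather than [n] keeps every interval nondegenerate, as the fundamental theorem
   requires. *)
pose I n : set R := [set` `[c - n.+1%:R, c + n.+1%:R]].
pose f_ n := (EFin \o f) \_ (I n).
have cF : continuous F.
  by move=> x; apply: differentiable_continuous; apply/derivable1_diffP; case: (dF x).
have fE n : (\int[mu]_x f_ n x = (F (c + n.+1%:R) - F (c - n.+1%:R))%:E)%E.
  rewrite /f_ -integral_mkcond; apply: (@continuous_FTC2 _ _ F).
  - by rewrite -subr_gt0 opprD opprK addrACA subrr add0r addr_gt0.
  - by apply: continuous_subspaceT => ?; exact: cf.
  - split.
    + by move=> x _; case: (dF x).
    + exact/cvg_at_right_filter/cF.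
    + exact/cvg_at_left_filter/cF.
  - by move=> x _; rewrite derive1E; case: (dF x).
have h : (\int[mu]_x f_ n x)%E @[n --> \oo] --> (\int[mu]_x (EFin \o f) x)%E.
  apply: (@dominated_cvg _ _ _ mu _ measurableT _ _ (abse \o (EFin \o f))) => //.
  - move=> n; apply: (measurable_restrictT (EFin \o f) (measurable_itv _)).1.
    exact: measurable_funTS.
  - move=> x _; apply: cvg_near_cst; near=> n.
    rewrite /f_ patchE ifT// inE /I /= in_itv/= -ler_distlC distrC.
    near: n; apply: filterS (nbhs_infty_gtr `|x - c|) => n /ltW xn.
    by rewrite (le_trans xn)// ler_nat.
  - exact: integrable_abse.
  - by move=> n x _; rewrite /f_ patchE; case: ifPn => //=; rewrite normr0 lee_fin.
have h0 : (\int[mu]_x f_ n x)%E @[n --> \oo] --> 0%:E.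
  under eq_fun do rewrite fE.
  apply: cvg_EFin; first exact: nearW.
  rewrite -(subr0 0); apply: cvgB; first by rewrite -cvg_shiftS in Fy.
  by rewrite -cvg_shiftS in FNy.
exact: (cvg_unique _ h h0).
Unshelve. all: by end_near. Qed.

End normal_density.

(** * Characteristic function of a normal law *)

Section characteristic_function.
Context {R : realType}.
Implicit Types m s t b x : R.
Local Notation mu := (@lebesgue_measure R).

(** From [exp y >= 1 + y] the density is at most a multiple of the harmonic sequence. Squaring the
    distance in the hypothesis covers both [m + n] and [m - n]. *)
Lemma cvg_normal_pdf_seq m s (u : nat -> R) : 0 < s ->
  (forall n, n%:R ^+ 2 <= (u n - m) ^+ 2) ->
  normal_pdf m s (u n) @[n --> \oo] --> 0.
Proof.
move=> s0 hu; have s1 : s != 0 by rewrite gt_eqF.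
rewrite -cvg_shiftS.
apply: (@squeeze_cvgr _ _ _ _ (cst 0) (fun n => (normal_peak s * (s ^+ 2 *+ 2)) * harmonic n)).
- apply: nearW => n; rewrite normal_pdf_ge0/= normal_pdfE// -mulrA.
  rewrite ler_wpM2l ?normal_peak_ge0//.
  rewrite /normal_fun mulNr expRN -[_ *+ 2 * _]invrK lef_pV2 ?posrE ?expR_gt0//; last first.
    by rewrite invr_gt0 mulr_gt0 ?pmulrn_lgt0 ?exprn_gt0 ?invr_gt0.
  rewrite invfM invrK.
  apply: le_trans (expR_ge1Dx _).
  rewrite ler_wpDl// mulrC ler_wpM2r ?invr_ge0 ?pmulrn_lge0 ?sqr_ge0//.
  apply: le_trans (hu n.+1).
  by rewrite expr2 ler_peMr// ler1n.
- exact: cvg_cst.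
- by rewrite -(mulr0 (normal_peak s * (s ^+ 2 *+ 2))); apply: cvgM;
    [exact: cvg_cst|exact: cvg_harmonic].
Qed.

(** Multiplied by [exp (s^2 t^2 / 2)], the integral has derivative [0] in [t], hence keeps its value
    [cos b] at [t = 0]. The free phase [b] covers cosine and sine at once, so no complex exponential
    appears. *)
Lemma Rintegral_cos_normal_pdf m s t b : 0 < s ->
  \int[mu]_x (cos (t * (x - m) + b) * normal_pdf m s x) =
  cos b * expR (- (s ^+ 2 * t ^+ 2 / 2)).
Proof.
move=> s0; have s1 : s != 0 by rewrite gt_eqF.
pose E t := expR (s ^+ 2 * t ^+ 2 / 2).
pose f t x := E t * (cos (t * (x - m) + b) * normal_pdf m s x).
pose g t x := E t * ((s ^+ 2 * t * cos (t * (x - m) + b) -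
  (x - m) * sin (t * (x - m) + b)) * normal_pdf m s x).
(* [g t x] is at once the derivative of [f] in [t] and, up to the factor
   [E t * s ^+ 2], the derivative of [sin (t (x - m) + b) * pdf x] in [x]. *)
have df x t' : is_derive t' 1 (f ^~ x) (g t' x).
  rewrite /f /g /E.
  by apply: is_derive_eq; rewrite /GRing.scale/=; field.
have mcos t' : measurable_fun [set: R] (fun x => cos (t' * (x - m) + b)).
  apply: (measurableT_comp (continuous_measurable_fun (@continuous_cos R))).
  by apply: measurable_funD => //; apply: measurable_funM => //; exact: measurable_funB.
have intc t' : mu.-integrable [set: R] (fun x => (cos (t' * (x - m) + b) * normal_pdf m s x)%:E).
  by apply: (@integrable_bounded_normal_pdf _ _ _ _ 1) => // x; exact: cos_max.
have intf t' : mu.-integrable [set: R] (EFin \o f t').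
  rewrite (_ : _ \o _ = fun x => (E t')%:E * (cos (t' * (x - m) + b) * normal_pdf m s x)%:E)%E//.
  exact: integrableZl.
(* Majorant of [g t'] valid for all [|t'| <= k]. It justifies differentiation under the integral
   sign, with [k = |t'| + 1] covering the unit neighbourhood of [t']. *)
pose D (k : R) x := expR (s ^+ 2 * k ^+ 2 / 2) *
  (s ^+ 2 * k * normal_pdf m s x + `|x - m| * normal_pdf m s x).
have intD k : mu.-integrable [set: R] (EFin \o D k).
  rewrite (_ : _ \o _ = fun x => (expR (s ^+ 2 * k ^+ 2 / 2))%:E *
    ((s ^+ 2 * k)%:E * (normal_pdf m s x)%:E +
     (`|x - m| * normal_pdf m s x)%:E))%E//.
  apply: integrableZl => //; apply: integrableD => //.
    by apply: integrableZl => //; exact: integrable_normal_pdf.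
  exact: integrable_norm_normal_pdf.
have gD k t' x : `|t'| <= k -> `|g t' x| <= D k x.
  move=> tk; rewrite /g /D normrM ger0_norm ?expR_ge0//.
  have k0 : 0 <= k by apply: le_trans tk.
  apply: ler_pM => //; first exact: expR_ge0.
    rewrite ler_expR ler_pM2r// ler_wpM2l ?sqr_ge0//.
    by rewrite -(real_normK (num_real t')) lerXn2r ?nnegrE.
  rewrite -mulrDl normrM (ger0_norm (normal_pdf_ge0 _ _ _)) ler_wpM2r ?normal_pdf_ge0//.
  apply: le_trans (ler_normB _ _) _; apply: lerD.
    rewrite -mulrA normrM (ger0_norm (sqr_ge0 s)) ler_wpM2l ?sqr_ge0//.
    by rewrite normrM -[leRHS]mulr1 ler_pM ?cos_max.
  by rewrite normrM ler_piMr// sin_max.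
pose F t' := \int[mu]_x f t' x.
have cg t' : continuous (g t').
  move=> x; apply: differentiable_continuous; apply/derivable1_diffP.
  have h := is_derive_normal_pdf m x s1.
  exact: ex_derive.
have intg t' : mu.-integrable [set: R] (EFin \o g t').
  apply: le_integrable (intD `|t'|) => //.
    by apply/measurable_EFinP; apply: continuous_measurable_fun; exact: cg.
  by move=> x _ /=; rewrite lee_fin (le_trans (gD _ _ _ (lexx _)))// ler_norm.
have sin0 t' (u : nat -> R) : (forall n, n%:R ^+ 2 <= (u n - m) ^+ 2) ->
    E t' * s ^+ 2 * (sin (t' * (u n - m) + b) * normal_pdf m s (u n)) @[n --> \oo] --> 0.
  move=> /(cvg_normal_pdf_seq s0) hu.
  rewrite -(mulr0 (E t' * s ^+ 2)); apply: cvgM; first exact: cvg_cst.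
  apply: (@squeeze_cvgr _ _ _ _ (fun n => - normal_pdf m s (u n))
    (fun n => normal_pdf m s (u n))) => //.
    apply: nearW => n; rewrite -ler_norml normrM (ger0_norm (normal_pdf_ge0 _ _ _)).
    by rewrite ler_piMl ?normal_pdf_ge0// sin_max.
  by rewrite -oppr0; exact: cvgN.
have intg0 t' : (\int[mu]_x (g t' x)%:E = 0)%E.
  apply: (@integralT_derivative_eq0 _
    (fun x => E t' * s ^+ 2 * (sin (t' * (x - m) + b) * normal_pdf m s x))
    (g t') m _ (cg t') (intg t') _ _).
  - move=> x; have h := is_derive_normal_pdf m x s1.
    by apply: is_derive_eq; rewrite /GRing.scale/= /g; field.
  - by apply: sin0 => n; rewrite addrAC subrr add0r.
  - by apply: sin0 => n; rewrite addrAC subrr add0r sqrrN.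
have dF t' : is_derive t' 1 F 0.
  have tI : `]t' - 1, t' + 1[%classic t' by rewrite /= in_itv/= ltrBlDr ltrDl ltr01.
  have I1 x : `]t' - 1, t' + 1[%classic x -> mu.-integrable [set: R] (EFin \o f x) by [].
  have I2 x y : `]t' - 1, t' + 1[%classic x -> [set: R] y -> derivable (f ^~ y) x 1.
    by move=> _ _; case: (df y x).
  have d1E x y : partial1of2 f x y = g x y.
    by rewrite partial1of2E; case: (df y x).
  have D0 y : 0 <= D (`|t'| + 1) y by apply: le_trans (gD _ 0 y _); rewrite ?normr0 ?addr_ge0.
  have I3 x y : `]t' - 1, t' + 1[%classic x -> [set: R] y ->
      `|partial1of2 f x y| <= D (`|t'| + 1) y.
    rewrite /= in_itv/= => /andP[h1 h2] _; rewrite d1E gD//.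
    by rewrite ler_norml; have := ler_norm t'; have := ler_norm (- t'); rewrite normrN; lra.
  have hd := @derivable_under_integral R _ _ mu f setT measurableT
    t' _ _ tI I1 I2 _ D0 (intD _) I3.
  have hv := @differentiation_under_integral R _ _ mu f setT measurableT
    t' _ _ tI I1 I2 _ D0 (intD _) I3.
  apply: DeriveDef => //.
  rewrite -derive1E [LHS]hv /=.
  by under eq_Rintegral do rewrite d1E; rewrite /Rintegral intg0.
have FE t' : F t' = E t' * \int[mu]_x (cos (t' * (x - m) + b) * normal_pdf m s x).
  by rewrite /F /f RintegralZl//; exact: intc.
have := is_derive_0_is_cst t 0 dF; rewrite !FE.
have -> : E 0 = 1 by rewrite /E expr0n/= mulr0 mul0r expR0.
have -> : \int[mu]_x (cos (0 * (x - m) + b) * normal_pdf m s x) = cos b.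
  under eq_Rintegral do rewrite mul0r add0r.
  rewrite RintegralZl//; last exact: integrable_normal_pdf.
  by rewrite /Rintegral integral_normal_pdf mulr1.
rewrite mul1r => <-; rewrite mulrAC expRN mulfV ?mul1r// gt_eqF//.
exact: expR_gt0.
Qed.

End characteristic_function.

(** * Bounded integrands and narrow normal kernels *)

Section finite_measure.
Context {R : realType}.
Implicit Types m s t b x : R.
Local Notation mu := (@lebesgue_measure R).

Lemma finite_measure_bounded_integrable d (T : measurableType d)
    (P : {finite_measure set T -> \bar R}) (f : T -> R) (k : R) :
  measurable_fun [set: T] f -> (forall w, `|f w| <= k) ->
  P.-integrable [set: T] (EFin \o f).
Proof.
move=> mf fk; apply: measurable_bounded_integrable => //.
  exact: fin_num_fun_lty (fin_num_measure P).
exists k; split; first exact: num_real.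
by move=> x kx y _; apply: le_trans (fk y) (ltW kx).
Qed.

End finite_measure.

Section bounded_integrals.
Context {R : realType}.
Implicit Types m s t b x : R.
Local Notation mu := (@lebesgue_measure R).

Lemma Rintegral_cos_normal_prob m s t b : 0 < s ->
  \int[normal_prob m s]_x cos (t * x + b) =
  cos (t * m + b) * expR (- (s ^+ 2 * t ^+ 2 / 2)).
Proof.
move=> s0; rewrite -(Rintegral_cos_normal_pdf m)// /Rintegral integral_normal_prob.
  congr fine; apply: eq_integral => x _; rewrite -EFinM; congr (cos _ * _)%:E.
  by ring.
apply: (@finite_measure_bounded_integrable _ _ _ _ _ 1) => [|x]; last exact: cos_max.
exact: measurable_cosM.
Qed.

(** Markov's inequality at the level of densities: on [A] the factor [|x - y| / e] is at least [1],
    and the first-moment bound replaces it by [4 s / e] times the density of standard deviation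
    [2 s], whose mass is at most [1]. *)
Lemma normal_prob_far_le y s (e : R) (A : set R) : 0 < s -> 0 < e ->
  measurable A -> (forall x, A x -> e <= `|x - y|) ->
  (normal_prob y s A <= (4 * s / e)%:E)%E.
Proof.
move=> s0 e0 mA Ae; rewrite /normal_prob.
have k0 : 0 <= 4 * s / e by rewrite divr_ge0 ?mulr_ge0// ltW.
have mpdf s' : measurable_fun A (EFin \o normal_pdf y s').
  by apply/measurable_EFinP/measurable_funTS; exact: measurable_normal_pdf.
apply: (@le_trans _ _ (\int[mu]_(x in A) ((4 * s / e)%:E * (normal_pdf y (2 * s) x)%:E))%E).
  apply: ge0_le_integral => //=.
  - by move=> x _; rewrite lee_fin normal_pdf_ge0.
  - exact: mpdf.
  - by apply: measurable_funeM; exact: mpdf.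
  - move=> x /Ae ex; rewrite -EFinM lee_fin mulrAC ler_pdivlMr//.
    apply: le_trans (normal_pdf_first_moment_le _ _ s0).
    by rewrite mulrC ler_wpM2r// normal_pdf_ge0.
rewrite ge0_integralZl//=; last 2 first.
- exact: mpdf.
- by move=> x _; rewrite lee_fin normal_pdf_ge0.
rewrite -[leRHS]mule1 lee_wpmul2l ?lee_fin//.
exact: (@probability_le1 _ _ _ (normal_prob y (2 * s))).
Qed.

(** The error is the mass that the law centred at [y] puts on the other side of [a], at distance at
    least [|y - a|]. Hence the smoothed indicator tends to the indicator as [s] tends to [0], except
    at [y = a]. *)
Lemma normal_prob_indic_le (y s a : R) : 0 < s -> y != a ->
  `|fine (normal_prob y s `]-oo, a]) - \1_(`]-oo, a]) y| <= 4 * s / `|y - a|.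
Proof.
move=> s0 ya.
have d0 : 0 < `|y - a| by rewrite normr_gt0 subr_eq0.
have mA : measurable [set` `]-oo, a]] by exact: measurable_itv.
have finA : normal_prob y s `]-oo, a] \is a fin_num by exact: fin_num_measure.
have [ay|] := ltP a y.
  rewrite indicE memNset; last by rewrite /= in_itv/= leNgt ay.
  rewrite subr0 ger0_norm ?fine_ge0//.
  rewrite -lee_fin fineK//; apply: normal_prob_far_le => // x /=.
  rewrite in_itv/= => xa; rewrite gtr0_norm ?subr_gt0// distrC.
  by rewrite (le_trans _ (ler_norm _))// lerB.
rewrite le_eqVlt (negbTE ya)/= => {}ya.
rewrite indicE mem_set; last by rewrite /= in_itv/= ltW.
rewrite distrC ger0_norm ?subr_ge0; last by rewrite -lee_fin fineK// probability_le1.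
rewrite -lee_fin EFinB fineK//.
have -> : (1 - normal_prob y s `]-oo, a])%E = normal_prob y s (~` `]-oo, a]).
  by rewrite -(probability_setC (normal_prob y s)).
apply: normal_prob_far_le => //; first exact: measurableC.
move=> x /=; rewrite in_itv/= => /negP; rewrite -ltNge => ax.
rewrite distrC (gtr0_norm (_ : 0 < a - y)) ?subr_gt0//.
by rewrite (le_trans _ (ler_norm _))// lerB// ltW.
Qed.

Lemma Rintegral_Fubini_bounded d1 d2 (T1 : measurableType d1) (T2 : measurableType d2)
    (P : probability T1 R) (Q : probability T2 R) (f : T1 -> T2 -> R) (k : R) :
  measurable_fun [set: T1 * T2] (fun z => f z.1 z.2) ->
  (forall w z, `|f w z| <= k) ->
  \int[P]_w \int[Q]_z f w z = \int[Q]_z \int[P]_w f w z.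
Proof.
move=> mf fk.
have iPQ : (P \x Q)%E.-integrable setT (EFin \o (fun z => f z.1 z.2)).
  apply: measurable_bounded_integrable => //.
    suff PQ1 : (P \x Q)%E [set: T1 * T2] = 1%E.
      by apply: (@le_lt_trans _ _ 1%E); [rewrite -PQ1|rewrite ltry].
    rewrite -setXTT; apply: etrans (product_measure1E P Q measurableT measurableT) _.
    exact: etrans (congr2 *%E (probability_setT P) (probability_setT Q)) (mule1 1%E).
  exists k; split; first exact: num_real.
  by move=> x kx z _; apply: le_trans (fk _ _) (ltW kx).
have mf1 w : measurable_fun setT (f w).
  exact: (measurableT_comp mf (pair1_measurable w)).
have mf2 (y : T2) : measurable_fun setT (f ^~ y).
  exact: (measurableT_comp mf (pair2_measurable y)).
have := Fubini iPQ => /= FE.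
rewrite /Rintegral; congr fine.
transitivity (\int[P]_w \int[Q]_z (f w z)%:E)%E.
  apply: eq_integral => x _; rewrite fineK//.
  by apply: integrable_fin_num => //; exact: (@finite_measure_bounded_integrable _ _ _ _ _ k).
rewrite FE; apply: eq_integral => y _; rewrite fineK//.
by apply: integrable_fin_num => //; exact: (@finite_measure_bounded_integrable _ _ _ _ _ k).
Qed.

End bounded_integrals.

(** * Fourier uniqueness: from cosines to half-lines *)

Section fourier_uniqueness.
Context {R : realType} d (T : measurableType d) (P : probability T R).
Variables (Y H : T -> R) (k : R).
Hypotheses (mY : measurable_fun [set: T] Y) (mH : measurable_fun [set: T] H).
Hypothesis Hk : forall w, `|H w| <= k.
Hypothesis cosH : forall t b, \int[P]_w (cos (t * Y w + b) * H w) = 0.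
Local Notation mu := (@lebesgue_measure R).

Lemma measurable_normal_pdf_rv s : s != 0 ->
  measurable_fun [set: T * R] (fun z => normal_pdf (Y z.1) s z.2).
Proof.
move=> s1.
rewrite (_ : (fun z => _) =
    fun z => normal_peak s * expR (- (z.2 - Y z.1) ^+ 2 / (s ^+ 2 *+ 2))).
  apply: measurable_funM => //; apply: measurableT_comp => //.
  apply: measurable_funM => //; apply: measurableT_comp => //.
  by apply: measurable_funX; apply: measurable_funB => //; exact: measurableT_comp.
by apply/funext => z; rewrite normal_pdfE.
Qed.

Lemma integrable_normal_pdf_rv s b : 0 < s ->
  P.-integrable [set: T] (fun w => (normal_pdf (Y w) s b * H w)%:E).
Proof.
move=> s0; have s1 : s != 0 by rewrite gt_eqF.
apply: (@finite_measure_bounded_integrable _ _ _ _ _ (normal_peak s * k)) => [|w].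
  apply: measurable_funM => //.
  exact: (measurableT_comp (measurable_normal_pdf_rv s1) (pair2_measurable b)).
rewrite normrM ler_pM// ger0_norm ?normal_pdf_ge0//.
exact: normal_pdf_ub.
Qed.

(** A Gaussian is its own Fourier transform: up to [normal_peak s], the density at [b] is the
    average of [cos ((Y w - b) / s * z)] over a standard normal [z]. After Fubini, [cosH] with
    frequency [z / s] and phase [- z b / s] kills the inner integral. *)
Lemma Rintegral_normal_pdf_eq0 s b : 0 < s ->
  \int[P]_w (normal_pdf (Y w) s b * H w) = 0.
Proof.
move=> s0; have s1 : s != 0 by rewrite gt_eqF.
pose f w z := cos ((Y w - b) / s * z + 0) * H w.
have pdfE w : (normal_peak s)^-1 * (normal_pdf (Y w) s b * H w) =
    \int[normal_prob 0 1]_z f w z.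
  rewrite normal_pdfE// -mulrA mulKf ?gt_eqF ?normal_peak_gt0//.
  rewrite RintegralZr//; last first.
    apply: (@finite_measure_bounded_integrable _ _ _ _ _ 1) => [|x]; last exact: cos_max.
    exact: measurable_cosM.
  rewrite Rintegral_cos_normal_prob// mulr0 addr0 cos0 mul1r; congr (expR _ * _).
  by field.
have mf : measurable_fun [set: T * R] (fun z => f z.1 z.2).
  apply: measurable_funM; last exact: measurableT_comp.
  apply: (measurableT_comp (continuous_measurable_fun (@continuous_cos R))).
  apply: measurable_funD => //; apply: measurable_funM => //.
  by apply: measurable_funM => //; apply: measurable_funB => //; exact: measurableT_comp.
have fk w z : `|f w z| <= k.
  by rewrite normrM -[leRHS]mul1r ler_pM// cos_max.
apply/eqP; have := @mulf_eq0 _ (normal_peak s)^-1 (\int[P]_w (normal_pdf (Y w) s b * H w)).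
rewrite invr_eq0 (gt_eqF (normal_peak_gt0 s1))/= => <-; apply/eqP.
rewrite -RintegralZl//; last exact: integrable_normal_pdf_rv.
under eq_Rintegral do rewrite pdfE.
rewrite (Rintegral_Fubini_bounded P (normal_prob 0 1) mf fk).
rewrite (_ : (fun z => _) = cst 0) ?/Rintegral ?integral0//.
apply/funext => z; rewrite -[RHS](cosH (z / s) (- (z * b / s))).
by apply: eq_Rintegral => w _; rewrite /f; congr (cos _ * _); field.
Qed.

(** The probability of the half-line is the Lebesgue integral over [b <= a] of the density at [b].
    Once the integrals are exchanged, each [b] contributes [0]. *)
Lemma Rintegral_normal_prob_eq0 s a : 0 < s ->
  \int[P]_w (fine (normal_prob (Y w) s `]-oo, a]) * H w) = 0.
Proof.
move=> s0; have s1 : s != 0 by rewrite gt_eqF.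
pose A : set R := [set` `]-oo, a]].
have mA : measurable A by exact: measurable_itv.
pose f (z : T * R) : \bar R := (\1_A z.2 * (normal_pdf (Y z.1) s z.2 * H z.1))%:E.
have A1 b : 0 <= (\1_A b : R) <= 1 by rewrite indicE; case: (_ \in _); rewrite lexx ler01.
have mf : measurable_fun [set: T * R] f.
  apply/measurable_EFinP; apply: measurable_funM.
    by apply: (measurableT_comp (measurable_indic mA)).
  apply: measurable_funM; last exact: measurableT_comp.
  exact: measurable_normal_pdf_rv.
have int_f w : (\int[mu]_b f (w, b) = (fine (normal_prob (Y w) s A) * H w)%:E)%E.
  rewrite EFinM fineK ?fin_num_measure//.
  under eq_integral do rewrite /f/= mulrA EFinM.
  rewrite integralZr//; last first.
    apply: (@integrable_bounded_normal_pdf _ _ _ _ 1) => [|x]; first exact: measurable_indic.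
    by rewrite ger0_norm; case/andP: (A1 x).
  congr (_ * _)%E; rewrite /normal_prob [RHS]integral_mkcond; apply: eq_integral => b _.
  by rewrite patchE indicE; case: (b \in A); rewrite ?mul1r ?mul0r.
(* [mu] is infinite, so boundedness of [f] is not enough for Fubini. The inner integral of [|f|] is
   at most [k] because the density has mass [1]. *)
have if_ : (P \x mu)%E.-integrable setT f.
  apply: (integrable12ltyP P mu mf).2.
  apply: (@le_lt_trans _ _ (\int[P]_w k%:E)%E); last first.
    by rewrite integral_cst//= probability_setT mule1 ltry.
  apply: ge0_le_integral => //.
  - by move=> w _; apply: integral_ge0.
  - by apply: (@measurable_fun_fubini_tonelli_F _ _ _ _ _ mu (abse \o f));
      [exact: (measurableT_comp (@abse_measurable R setT) mf)|move=> z; exact: abse_ge0].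
  - move=> w _.
    apply: (@le_trans _ _ (\int[mu]_b (k%:E * (normal_pdf (Y w) s b)%:E))%E).
      apply: ge0_le_integral => //=.
      + exact: (measurableT_comp (@abse_measurable R setT) (measurableT_comp mf (pair1_measurable w))).
      + by apply: measurable_funeM; apply/measurable_EFinP; exact: measurable_normal_pdf.
      + move=> b _; rewrite -EFinM lee_fin !normrM mulrCA [leRHS]mulrC.
        rewrite (ger0_norm (normal_pdf_ge0 _ _ _)) ler_wpM2l ?normal_pdf_ge0//.
        rewrite -[leRHS]mul1r ler_pM//.
        by rewrite ger0_norm; case/andP: (A1 b).
    rewrite integralZl//; last exact: integrable_normal_pdf.
    by rewrite integral_normal_pdf mule1.
have := Fubini if_.
under eq_integral do rewrite int_f.
rewrite /Rintegral => ->.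
rewrite (_ : (fun y => _) = cst 0%E) ?integral0//.
apply/funext => b; rewrite /f/=.
under eq_integral do rewrite EFinM.
rewrite integralZl//; last exact: integrable_normal_pdf_rv.
rewrite -[X in (_ * X)%E]fineK ?integrable_fin_num//; last exact: integrable_normal_pdf_rv.
by have := Rintegral_normal_pdf_eq0 b s0; rewrite /Rintegral => ->; rewrite mule0.
Qed.

Lemma measurable_normal_prob_rv s (A : set R) : s != 0 -> measurable A ->
  measurable_fun [set: T] (fun w => fine (normal_prob (Y w) s A)).
Proof.
move=> s1 mA.
pose f (z : T * R) : \bar R := (\1_A z.2 * (normal_pdf (Y z.1) s z.2))%:E.
have mf : measurable_fun [set: T * R] f.
  apply/measurable_EFinP; apply: measurable_funM.
    by apply: (measurableT_comp (measurable_indic mA)).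
  exact: measurable_normal_pdf_rv.
rewrite (_ : (fun w => _) = fine \o (fun w => \int[mu]_b f (w, b))%E).
  apply: measurableT_comp => //.
  apply: (@measurable_fun_fubini_tonelli_F _ _ _ _ _ mu f); first exact: mf.
  by move=> z; rewrite lee_fin mulr_ge0 ?normal_pdf_ge0.
apply/funext => w /=; congr fine; rewrite /normal_prob integral_mkcond.
apply: eq_integral => b _; rewrite /f /= patchE indicE.
by case: (b \in A); rewrite ?mul1r ?mul0r.
Qed.

(** Dominated convergence with widths [1 / (n + 1)] and majorant [k]. Pointwise convergence is
    available off the event [Y = a], which is null. *)
Lemma Rintegral_indic_le_eq0 a : P (Y @^-1` [set a]) = 0 ->
  \int[P]_w (\1_(`]-oo, a]) (Y w) * H w) = 0.
Proof.
move=> Ya0.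
pose A : set R := [set` `]-oo, a]].
have mA : measurable A by exact: measurable_itv.
pose u n : R := n.+1%:R^-1.
have u0 n : 0 < u n by rewrite invr_gt0.
pose f_ n w := (fine (normal_prob (Y w) (u n) A) * H w)%:E.
have mf n : measurable_fun setT (fun w => fine (normal_prob (Y w) (u n) A) * H w).
  apply: measurable_funM => //.
  by apply: measurable_normal_prob_rv => //; rewrite gt_eqF.
have fk n w : `|fine (normal_prob (Y w) (u n) A) * H w| <= k.
  rewrite normrM -[leRHS]mul1r ler_pM//.
  rewrite ger0_norm ?fine_ge0// -lee_fin fineK ?fin_num_measure//.
  exact: probability_le1.
have [|||||_ _] := @dominated_convergence _ _ _ P setT measurableT f_
  (fun w => (\1_A (Y w) * H w)%:E) (cst k%:E).
- by move=> n; exact/measurable_EFinP.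
- apply/measurable_EFinP; apply: measurable_funM => //.
  exact: (measurableT_comp (measurable_indic mA) mY).
- exists (Y @^-1` [set a]); split => //.
    by rewrite -[X in measurable X]setTI; exact: mY.
  move=> w /= ; apply: contra_notP => /eqP ya _.
  apply: cvg_EFin; first exact: nearW.
  apply: cvgM; last exact: cvg_cst.
  apply/subr_cvg0/norm_cvg0P.
  apply: (@squeeze_cvgr _ _ _ _ (cst 0) (fun n => 4 / `|Y w - a| * harmonic n)).
  - apply: nearW => n; rewrite normr_ge0/= mulrAC.
    exact: normal_prob_indic_le.
  - exact: cvg_cst.
  - by rewrite -(mulr0 (4 / `|Y w - a|)); apply: cvgM;
    [exact: cvg_cst|exact: cvg_harmonic].
- exact: finite_measure_integrable_cst.
- by apply: aeW => w n _; rewrite lee_fin.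
rewrite /sequence/f_ => h.
have h0 n : (\int[P]_x (fine (normal_prob (Y x) (u n) A) * H x)%:E = 0)%E.
  have := Rintegral_normal_prob_eq0 a (u0 n); rewrite /Rintegral => h0.
  rewrite -[LHS]fineK ?h0//; apply: integrable_fin_num => //.
  exact: (finite_measure_bounded_integrable P (mf n) (fk n)).
rewrite /Rintegral.
have -> : (\int[P]_x (\1_A (Y x) * H x)%:E = 0)%E.
  by move/cvg_lim : h => <-//; under eq_fun do rewrite h0; rewrite lim_cst.
by [].
Qed.
End fourier_uniqueness.

(** * Gaussian vectors: independence of the coordinates and orthant probabilities *)

Lemma measurable_orthant (R : realType) (d : nat) (a : d.-tuple R) :
  measurable (orthant a).
Proof.
rewrite (_ : orthant a =
    \bigcap_(i in [set: 'I_d]) ((fun x => tnth x i) @^-1` `]-oo, tnth a i])).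
  apply: fin_bigcap_measurable => // i _.
  rewrite -[X in measurable X]setTI; apply: measurable_tnth => //.
apply/seteqP; split => [x xa i _|x xa i]; first by rewrite /= in_itv/= xa.
by have := xa i I; rewrite /= in_itv.
Qed.

Section gaussian_vector.
Context {R : realType} {d : nat} dT (T : measurableType dT) (P : probability T R).
Variables (G : {RV P >-> d.-tuple R}) (m : d.-tuple R).
Hypothesis gaussG : gaussian_id_cov G m.

Lemma measurable_coord (i : 'I_d) : measurable_fun [set: T] (fun w => tnth (G w) i).
Proof. exact: (measurableT_comp (measurable_tnth i) (measurable_funPT G)). Qed.

Lemma measurable_lincomb (c : 'I_d -> R) :
  measurable_fun [set: T] (fun w => \sum_(i < d) c i * tnth (G w) i).
Proof.
by apply: measurable_sum => i; apply: measurable_funM => //; exact: measurable_coord.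
Qed.

Lemma measurable_cos_lincomb (c : 'I_d -> R) b :
  measurable_fun [set: T] (fun w => cos (\sum_(i < d) c i * tnth (G w) i + b)).
Proof.
apply: (measurableT_comp (continuous_measurable_fun (@continuous_cos R))).
by apply: measurable_funD => //; exact: measurable_lincomb.
Qed.

Lemma Rintegral_cos_gaussian (c : 'I_d -> R) b :
  \int[P]_w cos (\sum_(i < d) c i * tnth (G w) i + b) =
  cos (\sum_(i < d) c i * tnth m i + b) * expR (- ((\sum_(i < d) c i ^+ 2) / 2)).
Proof.
(* [gaussian_id_cov] speaks of nonzero coefficient vectors only. For [c = 0] both sides are
   [cos b]. *)
have [c0|/existsNP[i /eqP ci]] := pselect (forall i, c i = 0).
  have Z f : \sum_(i < d) c i * f i = 0 by apply: big1 => i _; rewrite c0 mul0r.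
  under eq_Rintegral do rewrite Z.
  rewrite Z [X in expR (- (X / _))]big1; last by move=> i _; rewrite c0 expr0n.
  rewrite Rintegral_cst//= mul0r oppr0 expR0.
  by rewrite (_ : fine _ = 1)// [X in fine X]probability_setT.
set S := \sum_(i < d) c i ^+ 2; set M := \sum_(i < d) c i * tnth m i.
have S0 : 0 < S.
  rewrite /S (bigD1 i)//= ltr_wpDr//; first by apply: sumr_ge0 => j _; exact: sqr_ge0.
  by rewrite exprn_even_gt0.
have -> : cos (M + b) * expR (- (S / 2)) = \int[normal_prob M (Num.sqrt S)]_x cos (1 * x + b).
  by rewrite Rintegral_cos_normal_prob ?sqrtr_gt0// mul1r expr1n mulr1 sqr_sqrtr// ltW.
pose Z w := \sum_(i < d) c i * tnth (G w) i.
have mZ : measurable_fun [set: T] Z by exact: measurable_lincomb.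
rewrite /Rintegral; congr fine.
have mcos : measurable_fun [set: R] (fun x => (cos (1 * x + b))%:E).
  by apply/measurable_EFinP; exact: measurable_cosM.
pose mZ' := isMeasurableFun.Build _ _ T (measurableTypeR R) Z mZ.
pose Z' : {RV P >-> measurableTypeR R} := HB.pack Z mZ'.
transitivity (\int[distribution P Z']_x (cos (1 * x + b))%:E)%E.
  rewrite integral_distribution//.
    by apply: eq_integral => w _ /=; rewrite mul1r.
  apply: (@finite_measure_bounded_integrable _ _ _ _ _ 1).
    exact: (measurableT_comp (measurable_cosM _ _)).
  by move=> w; exact: cos_max.

apply: eq_measure_integral => A mA _; apply: gaussG => //.
by exists i.
Qed.

Lemma gaussian_marginal (i : 'I_d) (A : set R) : measurable A ->
  P ((fun w => tnth (G w) i) @^-1` A) = normal_prob (tnth m i) 1 A.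
Proof.
move=> mA.
have := gaussG (c := fun j => (j == i)%:R) _ mA.
have E (f : 'I_d -> R) : \sum_(j < d) (j == i)%:R * f j = f i.
  rewrite (bigD1 i)//= eqxx mul1r big1 ?addr0// => j /negbTE ->.
  by rewrite mul0r.
rewrite E.
have -> : \sum_(j < d) (j == i)%:R ^+ 2 = 1 :> R.
  rewrite -[RHS](E (fun=> 1)); apply: eq_bigr => j _.
  by rewrite mulr1; case: (j == i); rewrite ?expr1n ?expr0n.
rewrite sqrtr1 => <-; last by exists i; rewrite eqxx oner_neq0.
rewrite /pushforward; congr (P _).
by apply/seteqP; split => w /=; rewrite E.
Qed.

Variable a : d.-tuple R.
Let p (i : 'I_d) : R := fine (normal_prob (tnth m i) 1 `]-oo, tnth a i]).
(** The guard [i < k], instead of a product over ['I_k], keeps the index type fixed in the induction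
    on [k]. *)
Let ind k w : R := \prod_(i < d | (i < k)%N) \1_(`]-oo, tnth a i]) (tnth (G w) i).

Let measurable_ind k : measurable_fun [set: T] (ind k).
Proof.
rewrite /ind; under eq_fun do rewrite -big_filter; apply: measurable_prod => i _.
exact: (measurableT_comp (measurable_indic (measurable_itv _)) (measurable_coord i)).
Qed.

Let ind_le1 k w : `|ind k w| <= 1.
Proof.
rewrite normr_prod; apply: prodr_ile1 => i _.
by rewrite normr_ge0/= indicE; case: (_ \in _); rewrite /= ?normr1 ?normr0 ?ler01.
Qed.

Lemma ord_ltnS_D1 (i0 : 'I_d) (F : 'I_d -> R) :
  \prod_(i < d | (i < i0.+1)%N) F i = F i0 * \prod_(i < d | (i < i0)%N) F i.
Proof.
rewrite (bigD1 i0)//=; congr (_ * _); apply: eq_bigl => i.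
by rewrite ltnS ltn_neqAle andbC.
Qed.

(** Independence one coordinate at a time: the first [k] coordinates are tested by half-line
    indicators, the others by a cosine. Let [Y] be coordinate [k]. The hypothesis at [k], used with
    [Y] added to the cosine, shows that cosines of [Y] are uncorrelated with the remaining factor
    [H0]. Fourier uniqueness, applied to [H0] minus its mean, extends this to the indicator of [Y].
    Arbitrary [c] and [b] are carried along because the step changes both. *)
Lemma Rintegral_ind_cos k : (k <= d)%N -> forall (c : 'I_d -> R) b,
  (forall i : 'I_d, (i < k)%N -> c i = 0) ->
  \int[P]_w (ind k w * cos (\sum_(i < d) c i * tnth (G w) i + b)) =
  (\prod_(i < d | (i < k)%N) p i) *
  (cos (\sum_(i < d) c i * tnth m i + b) * expR (- ((\sum_(i < d) c i ^+ 2) / 2))).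
Proof.
elim: k => [_ c b _|k IH kd c b c0].
  rewrite big_pred0_eq mul1r -Rintegral_cos_gaussian.
  by apply: eq_Rintegral => w _; rewrite /ind big_pred0_eq mul1r.
pose i0 := Ordinal kd.
have {}IH := IH (ltnW kd).
pose Y w := tnth (G w) i0.
have mY : measurable_fun [set: T] Y by exact: measurable_coord.
pose L w := \sum_(i < d) c i * tnth (G w) i + b.
pose H0 w := ind k w * cos (L w).
have mH0 : measurable_fun [set: T] H0.
  by apply: measurable_funM => //; exact: measurable_cos_lincomb.
have H01 w : `|H0 w| <= 1.
  by rewrite normrM -[leRHS]mulr1 ler_pM// cos_max.
have iH0 := finite_measure_bounded_integrable P mH0 H01.
pose e := \int[P]_w H0 w.
pose H w := H0 w - e.
have mH : measurable_fun [set: T] H by exact: measurable_funB.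
have Hk w : `|H w| <= 1 + `|e| by rewrite (le_trans (ler_normB _ _))// lerD.
have mcosY t b' : measurable_fun [set: T] (fun w => cos (t * Y w + b')).
  exact: (measurableT_comp (measurable_cosM _ _)).
have ibd (f : T -> R) : measurable_fun [set: T] f -> (forall w, `|f w| <= 1) ->
    P.-integrable [set: T] (EFin \o f).
  by move=> mf fk; exact: (finite_measure_bounded_integrable P mf fk).
have prod1 (f g : T -> R) : (forall w, `|f w| <= 1) -> (forall w, `|g w| <= 1) ->
    forall w, `|f w * g w| <= 1.
  by move=> f1 g1 w; rewrite normrM -[leRHS]mulr1 ler_pM.
have sub_mean (f : T -> R) : measurable_fun [set: T] f -> (forall w, `|f w| <= 1) ->
    \int[P]_w (f w * H w) = \int[P]_w (f w * H0 w) - (\int[P]_w f w) * e.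
  move=> mf f1; under eq_Rintegral do rewrite /H mulrBr.
  rewrite RintegralB//; first by rewrite RintegralZr//; exact: ibd.
    by apply: ibd; [exact: measurable_funM|exact: prod1].
  apply: (finite_measure_bounded_integrable P (k := `|e|)); first exact: measurable_funM.
  by move=> w; rewrite normrM ler_piMl.
have cosH t b' : \int[P]_w (cos (t * Y w + b') * H w) = 0.
  rewrite sub_mean//; last by move=> w; exact: cos_max.
  apply/eqP; rewrite subr_eq0; apply/eqP.
  have ci0 : c i0 = 0 by apply: c0.
  have ck (i : 'I_d) : (i < k)%N -> c i = 0 by move=> ik; apply: c0; rewrite ltnS ltnW.
  (* Coefficients of [r L + t Y], up to phases. Since [c i0 = 0], both [r = 1] and [r = -1] give the
     sum of squares [sum c_i^2 + t^2], so the exponential factor splits. *)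
  pose c1 (r : R) (i : 'I_d) := r * c i + t * (i == i0)%:R.
  have deltaE (f : 'I_d -> R) : \sum_(i < d) (i == i0)%:R * f i = f i0.
    by rewrite (bigD1 i0)//= eqxx mul1r big1 ?addr0// => i /negbTE ->; rewrite mul0r.
  have sumE r (x : d.-tuple R) : \sum_(i < d) c1 r i * tnth x i =
      r * (\sum_(i < d) c i * tnth x i) + t * tnth x i0.
    rewrite -(deltaE (tnth x)) !mulr_sumr -big_split/=; apply: eq_bigr => i _.
    by rewrite /c1; ring.
  have sqE r : r ^+ 2 = 1 -> \sum_(i < d) c1 r i ^+ 2 = \sum_(i < d) c i ^+ 2 + t ^+ 2.
    have ti0 : c1 r i0 = t by rewrite /c1 ci0 eqxx mulr0 add0r mulr1.
    move=> r1; rewrite (bigD1 i0)//= ti0 [in RHS](bigD1 i0)//= ci0 expr0n/= add0r addrC.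
    congr (_ + _).
    apply: eq_bigr => i /negbTE ii0; rewrite /c1 ii0 mulr0 addr0 exprMn r1 mul1r//.
  have c1k r (i : 'I_d) : (i < k)%N -> c1 r i = 0.
    move=> ik; rewrite /c1 ck// (_ : (i == i0) = false) ?mulr0 ?addr0//.
    by apply/negbTE; rewrite neq_ltn ik.
  have icos r b'' : P.-integrable [set: T]
      (fun w => (ind k w * cos (\sum_(i < d) c1 r i * tnth (G w) i + b''))%:E).
    apply: ibd; first by apply: measurable_funM => //; exact: measurable_cos_lincomb.
    by apply: prod1 => // w; exact: cos_max.
  (* The product-to-sum formula is used twice: here to split the product of cosines under the
     integral, and at the end to recombine the two resulting means. *)
  have cosM x y : cos x * cos y = 2^-1 * cos (y + x) + 2^-1 * cos (- y + x) :> R.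
    by rewrite !cosD cosN sinN; field.
  under eq_Rintegral => w _.
    rewrite (_ : _ * H0 w =
      2^-1 * (ind k w * cos (\sum_(i < d) c1 1 i * tnth (G w) i + (b + b'))) +
      2^-1 * (ind k w * cos (\sum_(i < d) c1 (-1) i * tnth (G w) i + (- b + b')))).
      over.
    rewrite /H0 mulrCA cosM mulrDr !(mulrCA (ind k w)) !sumE /L /Y.
    by congr (_ * (_ * cos _) + _ * (_ * cos _)); ring.
  have ihalf r b'' := integrableZl measurableT 2^-1 (icos r b'').
  rewrite RintegralD//; [|exact: ihalf|exact: ihalf].
  rewrite !RintegralZl//; [|exact: icos|exact: icos].
  rewrite (IH _ _ (c1k 1)) (IH _ _ (c1k (-1))).
  rewrite !sqE ?sqrrN ?expr1n// !sumE /e IH//.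
  have -> : \int[P]_w cos (t * Y w + b') = cos (t * tnth m i0 + b') * expR (- (t ^+ 2 / 2)).
    have sum0 (x : d.-tuple R) : \sum_(i < d) t * (i == i0)%:R * tnth x i = t * tnth x i0.
      by under eq_bigr do rewrite -mulrA; rewrite -mulr_sumr deltaE.
    rewrite -sum0.
    have -> : t ^+ 2 = \sum_(i < d) (t * (i == i0)%:R) ^+ 2.
      rewrite -[LHS](deltaE (fun=> t ^+ 2)); apply: eq_bigr => i _.
      by case: (i == i0); rewrite ?mulr1 ?mul1r// mulr0 mul0r expr0n.
    rewrite -Rintegral_cos_gaussian; apply: eq_Rintegral => w _.
    by rewrite sum0.
  rewrite mulrDl opprD expRD.
  set M := \sum_(i < d) _.
  rewrite (_ : 1 * M + t * tnth m i0 + (b + b') = (M + b) + (t * tnth m i0 + b')); last by ring.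
  rewrite (_ : -1 * M + t * tnth m i0 + (- b + b') = - (M + b) + (t * tnth m i0 + b')); last by ring.
  have := cosM (t * tnth m i0 + b') (M + b).
  set x1 := cos (t * _ + _); set x2 := cos (M + b); set x3 := cos (M + b + _); set x4 := cos (- _ + _).
  set A := expR _; set B := expR _; set C := \prod_(i < d | _) _ => h.
  by transitivity (C * (A * B) * (x1 * x2)); [rewrite h|]; ring.
(* A normal law has no atoms, so the boundary point [tnth a i0] is harmless. *)
have Ya0 : P (Y @^-1` [set tnth a i0]) = 0.
  by rewrite gaussian_marginal// /normal_prob integral_set1.
have := Rintegral_indic_le_eq0 mY mH Hk cosH Ya0.
rewrite sub_mean; last 2 first.
  exact: (measurableT_comp (measurable_indic (measurable_itv _)) mY).
  by move=> w; rewrite indicE; case: (_ \in _); rewrite /= ?normr1 ?normr0 ?ler01.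
move/eqP; rewrite subr_eq0 => /eqP h.
transitivity (\int[P]_w (\1_(`]-oo, tnth a i0]) (Y w) * H0 w)).
  by apply: eq_Rintegral => w _; rewrite /ind (ord_ltnS_D1 i0) -mulrA.
rewrite h.
have -> : \int[P]_w (\1_(`]-oo, tnth a i0]) (Y w)) = p i0.
  rewrite /p -gaussian_marginal; last exact: measurable_itv.
  have mYA : measurable (Y @^-1` `]-oo, tnth a i0]).
    by rewrite -[X in measurable X]setTI; apply: mY => //; exact: measurable_itv.
  rewrite /Rintegral; congr fine.
  transitivity (\int[P]_w (\1_(Y @^-1` `]-oo, tnth a i0]) w)%:E)%E => //.
  by rewrite integral_indic// setIT.
rewrite /e IH; first by rewrite (ord_ltnS_D1 i0) -[RHS]mulrA.
by move=> i ik; apply: c0; rewrite ltnS ltnW.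
Qed.

(** The case [k = d], [c = 0], [b = 0] of [Rintegral_ind_cos]: the cosine and the exponential are
    [1], and [ind d] is the indicator of the orthant event. *)
Lemma gaussian_orthant :
  P (G @^-1` orthant a) = (\prod_(i < d) fine (normal_prob (tnth m i) 1 `]-oo, tnth a i]))%:E.
Proof.
have := @Rintegral_ind_cos d (leqnn d) (fun=> 0) 0 (fun _ _ => erefl).
have Z (f : 'I_d -> R) : \sum_(i < d) 0 * f i = 0 by apply: big1 => i _; rewrite mul0r.
under eq_Rintegral do rewrite Z addr0 cos0 mulr1.
rewrite Z [X in expR (- (X / _))]big1; last by move=> i _; rewrite expr0n.
rewrite mul0r oppr0 expR0 addr0 cos0 !mulr1.
have E (f : 'I_d -> R) : \prod_(i < d | (i < d)%N) f i = \prod_(i < d) f i.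
  by apply: eq_bigl => i; rewrite ltn_ord.
rewrite E => <-.
have mO : measurable (G @^-1` orthant a).
  by rewrite -[X in measurable X]setTI; apply: measurable_funPT => //; exact: measurable_orthant.
rewrite /Rintegral; under eq_integral => w _.
  rewrite (_ : ind d w = \1_(G @^-1` orthant a) w).
    over.
  rewrite /ind E indicE; case: (boolP (w \in _)) => [|]; rewrite ?inE ?notin_setE /= => h.
    by apply: big1 => i _; rewrite indicE mem_set//= in_itv/=.
  move: h => /existsNP[i /negP ai]; rewrite (bigD1 i)//= indicE memNset ?mul0r//=.
  by rewrite in_itv/=; exact/negP.
by rewrite integral_indic// setIT fineK// fin_num_measure.
Qed.
End gaussian_vector.

(** * Gaussian anticoncentration for orthants *)

Section anticoncentration.
Context {R : realType}.
Implicit Types m A x u e : R.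
Local Notation mu := (@lebesgue_measure R).

Definition normal_cdf m x : R := fine (normal_prob m 1 `]-oo, x]).

Lemma normal_cdf_ge0 m x : 0 <= normal_cdf m x.
Proof. by rewrite fine_ge0. Qed.

Lemma normal_cdf_le1 m x : normal_cdf m x <= 1.
Proof.
rewrite -lee_fin fineK ?fin_num_measure//.
by apply: probability_le1; exact: measurable_itv.
Qed.

(** Beyond [m + A] the density is below its value there. Before [m + A], the difference of the two
    densities is the integral of [(z - m) phi(z)] from [u] to [m + A], at most [A] times the mass to
    the right of [x]. *)
Lemma normal_pdf_le_tail m A x u : 0 <= A -> x < u ->
  normal_pdf m 1 u <= A * (1 - normal_cdf m x) + normal_pdf m 1 (m + A).
Proof.
move=> A0 xu.
have t0 : 0 <= A * (1 - normal_cdf m x) by rewrite mulr_ge0// subr_ge0 normal_cdf_le1.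
have [Au|uA] := leP (m + A) u.
  apply: ler_wpDl => //; rewrite !normal_pdfE ?oner_neq0// ler_wpM2l ?normal_peak_ge0//.
  rewrite /normal_fun ler_expR !mulNr lerN2 ler_wpM2r ?invr_ge0 ?mulrn_wge0 ?sqr_ge0//.
  by rewrite lerXn2r ?nnegrE; lra.
have cpdf : continuous (normal_pdf m 1) by apply: continuous_normal_pdf; exact: oner_neq0.
have dpdf (z : R) : is_derive z 1 (fun z => - normal_pdf m 1 z) ((z - m) * normal_pdf m 1 z).
  have h := is_derive_normal_pdf m z (oner_neq0 R).
  by apply: is_derive_eq; rewrite expr1n divr1 mulNr opprK.
have cf : continuous (fun z => (z - m) * normal_pdf m 1 z).
  move=> z; apply: cvgM; last exact: cpdf.
  by apply: cvgB; [exact: cvg_id|exact: cvg_cst].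
have cF : continuous (fun z => - normal_pdf m 1 z).
  by move=> z; apply: cvgN; exact: cpdf.
have mI : measurable [set` `[u, m + A]] by exact: measurable_itv.
have FTC : (\int[mu]_(z in `[u, (m + A)%R]) ((z - m) * normal_pdf m 1 z)%:E =
    (- normal_pdf m 1 (m + A))%:E - (- normal_pdf m 1 u)%:E)%E.
  apply: (@continuous_FTC2 _ _ (fun z => - normal_pdf m 1 z)) => //.
  - by apply: continuous_subspaceT => z; exact: cf.
  - split.
    + by move=> z _; case: (dpdf z).
    + exact/cvg_at_right_filter/cF.
    + exact/cvg_at_left_filter/cF.
  - by move=> z _; rewrite derive1E; case: (dpdf z).
have ipdf : mu.-integrable `[u, (m + A)%R] (fun z => (normal_pdf m 1 z)%:E).
  by apply: (integrableS measurableT) => //; exact: integrable_normal_pdf.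
suff : (((- normal_pdf m 1 (m + A))%:E - (- normal_pdf m 1 u)%:E) <= (A * (1 - normal_cdf m x))%:E)%E.
  by rewrite -EFinB lee_fin; lra.
rewrite -FTC.
apply: (@le_trans _ _ (\int[mu]_(z in `[u, (m + A)%R]) (A%:E * (normal_pdf m 1 z)%:E))%E).
  apply: le_integral => //.
  - apply: continuous_compact_integrable; first exact: segment_compact.
    by apply: continuous_subspaceT => z; exact: cf.
  - exact: integrableZl.
  - move=> z; rewrite inE/= in_itv/= => /andP[_ zA]; rewrite -EFinM lee_fin.
    by rewrite ler_wpM2r ?normal_pdf_ge0//; lra.
rewrite integralZl// EFinM; apply: lee_wpmul2l; first by rewrite lee_fin.
rewrite EFinB fineK ?fin_num_measure//.
have mx : measurable [set` `]-oo, x]] by exact: measurable_itv.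
have -> : (1 - normal_prob m 1 `]-oo, x])%E = normal_prob m 1 (~` `]-oo, x]).
  by rewrite -(probability_setC (normal_prob m 1)).
rewrite -/(normal_prob m 1 _); apply: le_measure; rewrite ?inE//; first exact: measurableC.
by move=> z /=; rewrite !in_itv/= => /andP[uz _]; apply/negP; rewrite -ltNge (lt_le_trans xu).
Qed.

(** The tail bound does not depend on [u], so integrating it over an interval of length [e]
    multiplies it by [e]. The shape [p + dl (1 - p) + eta] is the one [prod_perturbation_le]
    takes. *)
Lemma normal_cdf_increment m A x e : 0 <= A -> 0 <= e ->
  normal_cdf m (x + e) <=
  normal_cdf m x + (e * A) * (1 - normal_cdf m x) + e * normal_pdf m 1 (m + A).
Proof.
move=> A0 e0; set c := A * (1 - normal_cdf m x) + normal_pdf m 1 (m + A).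
suff : (normal_prob m 1 `]-oo, (x + e)%R] <= (normal_cdf m x + e * c)%:E)%E.
  rewrite -[X in (X <= _)%E]fineK ?fin_num_measure//.
  by rewrite lee_fin /c mulrDr mulrA addrA.
have mx : measurable [set` `]-oo, x]] by exact: measurable_itv.
have mxe : measurable [set` `]x, (x + e)]] by exact: measurable_itv.
have -> : `]-oo, (x + e)%R]%classic = `]-oo, x] `|` `]x, (x + e)%R].
  by rewrite -itv_bndbnd_setU// bnd_simp ?lerDl.
have c0 : 0 <= c by rewrite addr_ge0 ?normal_pdf_ge0// mulr_ge0// subr_ge0 normal_cdf_le1.
apply: (le_trans (@measureU2 _ _ _ (normal_prob m 1) _ _ mx mxe)).
rewrite EFinD fineK ?fin_num_measure//; apply: leeD => //.
apply: (@le_trans _ _ (\int[mu]_(z in `]x, (x + e)%R]) c%:E)%E).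
  apply: ge0_le_integral => //.
  - by move=> z _; rewrite lee_fin normal_pdf_ge0.
  - by apply/measurable_EFinP/measurable_funTS; exact: measurable_normal_pdf.
  - by move=> z /=; rewrite in_itv/= => /andP[xz _]; rewrite lee_fin normal_pdf_le_tail.
rewrite integral_cst//= lebesgue_measure_itv/= lte_fin.
case: ifPn => [_|_]; last by rewrite mule0 lee_fin mulr_ge0.
by rewrite -EFinB -EFinM lee_fin addrAC subrr add0r mulrC.
Qed.

(** Moving every factor towards [1] by the fraction [dl] moves the product by at most that same
    fraction. Thus [dl] is paid once and only [eta] is multiplied by the number of factors; this is
    what leaves [sqrt (ln (d + 1))] instead of a power of [d]. *)
Lemma prod_perturbation_le (I : Type) (s : seq I) (p q : I -> R) (dl eta : R) :
  0 <= dl <= 1 -> 0 <= eta ->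
  (forall i, 0 <= p i <= 1) -> (forall i, 0 <= q i <= 1) ->
  (forall i, q i <= p i + dl * (1 - p i) + eta) ->
  \prod_(i <- s) q i <= (1 - dl) * \prod_(i <- s) p i + dl + (size s)%:R * eta.
Proof.
move=> /andP[dl0 dl1] eta0 p01 q01 qp.
elim: s => [|i s IH]; first by rewrite !big_nil/=; lra.
rewrite !big_cons/= -natr1.
have Q01 : 0 <= \prod_(j <- s) q j <= 1.
  by rewrite prodr_ge0 ?prodr_ile1// => j _; case/andP: (q01 j).
have P01 : 0 <= \prod_(j <- s) p j <= 1.
  by rewrite prodr_ge0 ?prodr_ile1// => j _; case/andP: (p01 j).
move: IH Q01 P01 (p01 i) (q01 i) (qp i) (ler0n R (size s)).
move: (\prod_(j <- s) q j) (\prod_(j <- s) p j) (p i) (q i) (size s)%:R => Q P pi qi n.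
move=> IH /andP[Q0 Q1] /andP[P0 P1] /andP[pi0 pi1] /andP[qi0 qi1] qpi n0.
set r := pi + dl * (1 - pi).
have r1 : r <= 1 by rewrite /r; nra.
have r0 : 0 <= r by rewrite /r; nra.
have h1 : qi * Q <= (r + eta) * Q by rewrite ler_wpM2r.
have h2 : eta * Q <= eta by rewrite ler_piMr.
have h3 : r * Q <= r * ((1 - dl) * P + dl + n * eta) by rewrite ler_wpM2l.
have h4 : r * (n * eta) <= n * eta by rewrite ler_piMl// mulr_ge0.
(* Convexity: the product over [s] of [p + dl (1 - p)] lies below its chord. *)
have h5 : 0 <= dl * (1 - dl) * ((1 - P) * (1 - pi)) by rewrite !mulr_ge0// subr_ge0.
rewrite /r in h1 h2 h3 h4 *; lra.
Qed.

(** [exp (-1/2) >= 1 - 1/2] gives [exp (1/2) <= 2 <= d + 1]. *)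
Lemma ln_natS_ge (d : nat) : (1 <= d)%N -> 1 / 2 <= ln (d.+1%:R : R).
Proof.
move=> d1; rewrite -[leLHS]expRK ler_ln ?posrE ?expR_gt0//.
apply: (@le_trans _ _ 2); last by rewrite ler_nat.
rewrite -[expR _]invrK -[2 in leRHS]invrK lef_pV2 ?posrE ?invr_gt0 ?expR_gt0//.
by rewrite -expRN; apply: le_trans (expR_ge1Dx _); lra.
Qed.

Lemma prod_normal_cdf_increment (d : nat) (m x : 'I_d -> R) e : (1 <= d)%N -> 0 <= e ->
  \prod_(i < d) normal_cdf (m i) (x i + e) <=
  \prod_(i < d) normal_cdf (m i) (x i) + e * (9 / 4 * Num.sqrt (ln d.+1%:R)).
Proof.
move=> d1 e0; set l : R := ln d.+1%:R; set L := Num.sqrt l.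
have l2 : 1 / 2 <= l by exact: ln_natS_ge.
have L2 : L ^+ 2 = l by rewrite sqr_sqrtr//; lra.
have L0 : 0 <= L by exact: sqrtr_ge0.
(* With [A^2 = 2 ln (d + 1)] the density at [m + A] is [normal_peak 1 / (d + 1)], so [d] such errors
   add up to at most the peak. *)
pose A := Num.sqrt 2 * L.
have s2 : Num.sqrt 2 <= 3 / 2 :> R.
  by rewrite -(ger0_norm (_ : 0 <= 3 / 2 :> R))// -sqrtr_sqr ler_sqrt; lra.
have A0 : 0 <= A by rewrite mulr_ge0 ?sqrtr_ge0.
have AL : A <= 3 / 2 * L by rewrite ler_wpM2r.
pose phi : R := normal_peak 1 * d.+1%:R^-1.
have phiE mi : normal_pdf mi 1 (mi + A) = phi.
  rewrite normal_pdfE ?oner_neq0// /phi; congr (_ * _).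
  rewrite /normal_fun addrAC subrr add0r exprMn L2 sqr_sqrtr// expr1n.
  rewrite mulNr -mulr_natr mul1r mulrAC mulfV ?mul1r// expRN lnK//.
  by rewrite posrE.
(* The peak is [1 / sqrt (2 pi)], and [pi >= 2]. *)
have peak2 : normal_peak 1 <= 1 / 2 :> R.
  rewrite /normal_peak mul1r lef_pV2 ?posrE//.
    rewrite -[leLHS](ger0_norm (_ : 0 <= 2))// -sqrtr_sqr ler_sqrt.
      by rewrite expr1n mul1r -mulr_natr; have := pi_ge2 R; lra.
    by rewrite expr1n mul1r mulrn_wge0// pi_ge0.
  by rewrite sqrtr_gt0 expr1n mul1r mulrn_wgt0// pi_gt0.
have phi0 : 0 <= phi by rewrite mulr_ge0 ?normal_peak_ge0// invr_ge0.
have dphi : d%:R * phi <= 1 / 2.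
  rewrite /phi mulrCA (le_trans _ peak2)// ler_piMr ?normal_peak_ge0//.
  by rewrite ler_pdivrMr// mul1r ler_nat.
have L23 : 2 / 3 <= L.
  by rewrite -(ger0_norm (_ : 0 <= 2 / 3 :> R))// -sqrtr_sqr ler_sqrt; lra.
have cdf01 mi xi : 0 <= normal_cdf mi xi <= 1 by rewrite normal_cdf_ge0 normal_cdf_le1.
have P0 : 0 <= \prod_(i < d) normal_cdf (m i) (x i).
  by apply: prodr_ge0 => i _; exact: normal_cdf_ge0.
(* [A <= (3/2) L], and [L >= 2/3] turns the constant [1/2] into [(3/4) L]; the sum is [(9/4) L]. *)
have AdL : A + d%:R * phi <= 9 / 4 * L by lra.
apply: (@le_trans _ _ (\prod_(i < d) normal_cdf (m i) (x i) + e * (A + d%:R * phi))); last first.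
  by rewrite lerD2l ler_wpM2l.
have eA0 : 0 <= e * A by rewrite mulr_ge0.
have ephi0 : 0 <= e * phi by rewrite mulr_ge0.
have dn0 : 0 <= d%:R * (e * phi) by rewrite mulr_ge0.
have eE : e * (A + d%:R * phi) = e * A + d%:R * (e * phi) by ring.
(* If [e A >= 1] the right side already exceeds any probability; otherwise [dl = e A] is an
   admissible fraction. *)
have [eA1|eA1] := leP 1 (e * A).
  apply: (@le_trans _ _ 1); last by rewrite eE; lra.
  by apply: prodr_ile1 => i _; exact: cdf01.
have := @prod_perturbation_le _ (index_enum 'I_d) (fun i => normal_cdf (m i) (x i))
  (fun i => normal_cdf (m i) (x i + e)) (e * A) (e * phi).
rewrite eA0 (ltW eA1) => /(_ isT ephi0 (fun i => cdf01 _ _) (fun i => cdf01 _ _)) h.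
apply: le_trans (h _) _.
  by move=> i; rewrite -(phiE (m i)); exact: normal_cdf_increment.
rewrite [size _](_ : _ = d); last by rewrite /index_enum unlock -enumT size_enum_ord.
by rewrite eE; have := mulr_ge0 eA0 P0; lra.
Qed.
End anticoncentration.

(** * Couplings and the comparison of orthants *)

Section coupling.
Context {R : realType} {d : nat}.

Lemma coord_le_eucl_norm (x : d.-tuple R) (i : 'I_d) : `|tnth x i| <= eucl_norm x.
Proof.
rewrite -sqrtr_sqr ler_sqrt; last by apply: sumr_ge0 => j _; exact: sqr_ge0.
by rewrite (bigD1 i)//= lerDl sumr_ge0// => j _; exact: sqr_ge0.
Qed.

Lemma eucl_norm_distC (x y : d.-tuple R) :
  eucl_norm [tuple tnth x i - tnth y i | i < d] =
  eucl_norm [tuple tnth y i - tnth x i | i < d].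
Proof.
by congr Num.sqrt; apply: eq_bigr => i _; rewrite !tnth_mktuple -sqrrN opprB.
Qed.

(** If [V] violates a constraint of the enlarged orthant while [U] satisfies those of [a], one
    coordinate of [U - V], hence its norm, is at least [e]. Keeping [U] and [V] generic allows their
    roles to be exchanged. *)
Lemma coupling_orthant_le dO (O : measurableType dO) (Q : probability O R)
    (U V : {RV Q >-> d.-tuple R}) (a : d.-tuple R) (e r : R) : 0 < e ->
  (\int[Q]_w (eucl_norm [tuple tnth (U w) i - tnth (V w) i | i < d])%:E = r%:E)%E ->
  (Q (U @^-1` orthant a) <=
   Q (V @^-1` orthant [tuple (tnth a i + e)%R | i < d]) + (r / e)%R%:E)%E.
Proof.
move=> e0 rE.
pose n w := eucl_norm [tuple tnth (U w) i - tnth (V w) i | i < d].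
have n0 w : 0 <= n w by exact: sqrtr_ge0.
have mn : measurable_fun [set: O] n.
  apply: (measurableT_comp (continuous_measurable_fun (@sqrt_continuous R))).
  apply: measurable_sum => i; under eq_fun do rewrite tnth_mktuple.
  by apply: measurable_funX; apply: measurable_funB; exact: measurable_coord.
have mO (W : {RV Q >-> d.-tuple R}) b : measurable (W @^-1` orthant b).
  by rewrite -[X in measurable X]setTI; apply: measurable_funPT => //; exact: measurable_orthant.
pose E := [set w | e <= n w].
have mE : measurable E.
  rewrite (_ : E = n @^-1` `[e, +oo[); last first.
    by apply/seteqP; split => w /=; rewrite in_itv/= andbT.
  by rewrite -[X in measurable X]setTI; apply: mn => //; exact: measurable_itv.
have markov : (Q E <= (r / e)%R%:E)%E.
  rewrite mulrC EFinM -lee_pdivrMl ?invr_gt0// invrK -rE.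
  rewrite -(setIT E) -integral_indic// -ge0_integralZl//; last 2 first.
  - by apply/measurable_EFinP; exact: measurable_indic.
  - by rewrite lee_fin ltW.
  apply: ge0_le_integral => //.
  - by move=> w _; rewrite -EFinM lee_fin mulr_ge0// ltW.
  - by apply: measurable_funeM; apply/measurable_EFinP; exact: measurable_indic.
  - exact/measurable_EFinP.
  - move=> w _; rewrite -EFinM lee_fin indicE.
    case: (boolP (w \in E)); rewrite ?inE => h; first by rewrite mulr1.
    by rewrite mulr0; exact: n0.
apply: (@le_trans _ _ (Q (V @^-1` orthant [tuple (tnth a i + e)%R | i < d]) + Q E)%E); last first.
  exact: leeD2l.
apply: le_trans (measureU2 _ _ _) => //.
apply: le_measure; rewrite ?inE//; first exact: measurableU.
move=> w Ua; have [?|] := pselect (orthant [tuple (tnth a i + e)%R | i < d] (V w)); first by left.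
move=> /existsNP[i]; rewrite tnth_mktuple => /negP; rewrite -ltNge => aV; right.
apply: le_trans (coord_le_eucl_norm _ i); rewrite tnth_mktuple.
have := Ua i; rewrite distrC => Uai.
by rewrite (le_trans _ (ler_norm _))//; lra.
Qed.

End coupling.

Lemma gaussian_orthant_increment (R : realType) (d : nat) dT (T : measurableType dT)
    (P : probability T R) (G : {RV P >-> d.-tuple R}) (m a : d.-tuple R) (e : R) :
  (1 <= d)%N -> gaussian_id_cov G m -> 0 <= e ->
  (P (G @^-1` orthant [tuple (tnth a i + e)%R | i < d]) <=
   P (G @^-1` orthant a) + (e * (9 / 4 * Num.sqrt (ln d.+1%:R)))%R%:E)%E.
Proof.
move=> d1 gG e0; rewrite !(gaussian_orthant gG) -EFinD lee_fin.
under eq_bigr do rewrite tnth_mktuple.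
exact: (prod_normal_cdf_increment (tnth m) (tnth a)).
Qed.

Theorem theorem3p3 (R : realType) (d : nat) (hd : (1 <= d)%N)
    (dT : measure_display) (T : measurableType dT) (P : probability T R)
    (X : {RV P >-> d.-tuple R})
    (dT' : measure_display) (T' : measurableType dT') (P' : probability T' R)
    (G : {RV P' >-> d.-tuple R}) (m : d.-tuple R) :
  gaussian_id_cov G m ->
  (kolmogorov_dist X G
   <= (3 * (ln (d.+1)%:R) `^ (4^-1))%:E * sqrte (wasserstein1 X G))%E.
Proof.
move=> gG; set l : R := ln d.+1%:R; set c := 3 * l `^ 4^-1.
have l2 : 1 / 2 <= l by exact: ln_natS_ge.
have l0 : 0 < l by lra.
have c0 : 0 < c by rewrite mulr_gt0// powR_gt0.
pose C := 9 / 4 * Num.sqrt l.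
have C0 : 0 < C by rewrite mulr_gt0// sqrtr_gt0.
(* The minimum over [e] of [r / e + e C] is [sqrt (4 C r)], and [4 (9/4) = 3^2] produces the
   constant [3]. *)
have c2 : c ^+ 2 = 4 * C.
  rewrite exprMn -(powR_mulrn 2 (powR_ge0 l 4^-1)) -powRrM (_ : 4^-1 * 2%:R = 2^-1); last by field.
  by rewrite powR12_sqrt ?ltW// /C; field.
apply: ge_ereal_sup => _ [a _ <-].
have mO dO (O : measurableType dO) (Q : probability O R) (W : {RV Q >-> d.-tuple R}) b :
    measurable (W @^-1` orthant b).
  by rewrite -[X in measurable X]setTI; apply: measurable_funPT => //; exact: measurable_orthant.
have finO dO (O : measurableType dO) (Q : probability O R) (W : {RV Q >-> d.-tuple R}) b :
    Q (W @^-1` orthant b) \is a fin_num by rewrite fin_num_measure.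
rewrite -(fineK (finO _ _ P X a)) -(fineK (finO _ _ P' G a)) -EFinB abse_EFin.
set x := fine (P _); set y := fine (P' _).
set k := `|x - y|.
have k0 : 0 <= k by exact: normr_ge0.
(* Solving for the distance turns the claim into a lower bound on the cost of every coupling, which
   passes to the infimum even when it is infinite. *)
suff kW : (((k / c) ^+ 2)%:E <= wasserstein1 X G)%E.
  have : (sqrte ((k / c) ^+ 2)%:E <= sqrte (wasserstein1 X G))%E.
    rewrite lee_sqrt//; apply: le_trans kW; rewrite lee_fin sqr_ge0//.
  rewrite /= sqrtr_sqr ger0_norm ?divr_ge0 ?(ltW c0)//.
  move=> /(lee_wpmul2l (_ : 0 <= c%:E)%E); rewrite lee_fin (ltW c0) => /(_ isT).
  by rewrite -EFinM mulrC divfK// gt_eqF.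
apply: (@le_ereal_inf_tmp R _ ((k / c) ^+ 2)%:E) => s [dO [Om [Q [U [V [UX [VG ->]]]]]]].
set r := (\int[Q]_w _)%E.
have r0 : (0 <= r)%E by apply: integral_ge0 => w _; rewrite lee_fin sqrtr_ge0.
have [ry|] := eqVneq r +oo%E; first by rewrite ry leey.
move=> rNy; have rfin : r \is a fin_num by rewrite ge0_fin_numE// ltey.
have rE : r = (fine r)%:E by rewrite fineK.
have rE' : (\int[Q]_w (eucl_norm [tuple tnth (V w) i - tnth (U w) i | i < d])%:E = (fine r)%:E)%E.
  by rewrite -rE; apply: eq_integral => w _; rewrite eucl_norm_distC.
have QU b : Q (U @^-1` orthant b) = P (X @^-1` orthant b).
  exact: (UX _ (measurable_orthant b)).
have QV b : Q (V @^-1` orthant b) = P' (G @^-1` orthant b).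
  exact: (VG _ (measurable_orthant b)).
have up e : 0 < e -> k <= fine r / e + e * C.
  move=> e0.
  have h1 := coupling_orthant_le a e0 rE.
  have h2 := gaussian_orthant_increment a hd gG (ltW e0).
  (* The lower estimate starts from the shrunken orthant: [V] below [a - e] forces [U] below [a] up
     to [r / e], and the Gaussian mass between [a - e] and [a] is at most [e C]. *)
  pose b := [tuple tnth a i - e | i < d].
  have h3 := coupling_orthant_le b e0 rE'.
  have h4 := gaussian_orthant_increment b hd gG (ltW e0).
  have ba : [tuple tnth b i + e | i < d] = a.
    by apply: eq_from_tnth => i; rewrite !tnth_mktuple subrK.
  rewrite ba in h3 h4.
  rewrite QU QV in h1; rewrite QU QV in h3.
  move: h1 h2 h3 h4.
  rewrite -(fineK (finO _ _ P X a)) -(fineK (finO _ _ P' G a)) -/x -/y.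
  rewrite -(fineK (finO _ _ P' G b)) -(fineK (finO _ _ P' G [tuple (tnth a i + e)%R | i < d])).
  rewrite -!EFinD !lee_fin -/C => h1 h2 h3 h4.
  by rewrite ler_norml; lra.
have C4 : 0 < 4 * C by lra.
rewrite rE lee_fin expr_div_n c2 ler_pdivrMr//.
have fr0 : 0 <= fine r by rewrite fine_ge0.
have [->|kn0] := eqVneq k 0; first by rewrite expr0n/= mulr_ge0// mulr_ge0// ltW.
have kp : 0 < k by rewrite lt_neqAle eq_sym kn0.
(* With [e = k / (2 C)] the term [e C] is [k / 2], leaving [k^2 <= 4 C r]. Choosing [e] from [k]
   rather than as the minimiser [sqrt (r / C)] keeps it positive when [r = 0]. *)
have e0 : 0 < k / (2 * C) by rewrite divr_gt0// mulr_gt0.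
have := up _ e0.
have -> : fine r / (k / (2 * C)) + k / (2 * C) * C = (4 * C * fine r + k ^+ 2) / (2 * k).
  by field; rewrite kn0 gt_eqF.
by rewrite ler_pdivlMr ?mulr_gt0//; lra.
Qed.
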